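(* Let $q\geq 4$ be a prime power and let $\mathcal{C}$ be a non-trivial real conjugacy class in $\mathrm{PSL}_2(q)$. Then the Killing form $K_{\mathcal{C}}$ is non-degenerate.
   Context: $\mathrm{PSL}_2(q)=\mathrm{SL}_2(q)/Z(\mathrm{SL}_2(q))$, over the field $\mathbb{F}_q$ with $q$ elements. A conjugacy class is real if it is stable under inversion; it is non-trivial if it is not $\{1\}$. For a subset $\mathcal{C}\subset G\setminus\{1\}$ of a finite group $G$ stable under conjugation by $G$, let $\mathbb{C}\mathcal{C}$ be the complex vector space with basis $\mathcal{C}$. The Killing form $K_{\mathcal{C}}$ is the bilinear form on $\mathbb{C}\mathcal{C}$ given on basis elements $a,b\in\mathcal{C}$ by $K_{\mathcal{C}}(a,b)=|C_G(ab)\cap\mathcal{C}|$, where $C_G(ab)$ is the centralizer of $ab$ in $G$. It is non-degenerate if the matrix $(K_{\mathcal{C}}(a,b))_{a,b\in\mathcal{C}}$ is invertible. *)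

(* Defs.v *)
From HB Require Import structures.
From mathcomp Require Import all_boot all_order all_algebra all_fingroup all_solvable.
From mathcomp Require Import complex reals.

Set Implicit Arguments.
Unset Strict Implicit.
Unset Printing Implicit Defensive.

Import GRing.Theory.
Local Open Scope ring_scope.

Section SpecialLinear.
Variables (n : nat) (F : finComUnitRingType).
Local Open Scope group_scope.

(* {'GL_n[F]} has n x n matrices for n > 0 only: n = 0 gives size 1. *)
Definition SL : {set {'GL_n[F]}} := [set u | (\det (GLval u) == 1)%R].

Lemma SL_group_set : group_set SL.
Proof.
apply/group_setP; split=> [|u v]; first by rewrite inE GL_1E det1.
by rewrite !inE GL_ME det_mulmx => /eqP-> /eqP->; rewrite mulr1.
Qed.

Canonical SL_group := group SL_group_set.

Definition PSL := (SL / 'Z(SL))%G.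

End SpecialLinear.

Section KillingForm.
Variables (K : fieldType) (gT : finGroupType) (G : {group gT}) (C : {set gT}).

Definition killing_coef (a b : gT) : nat := #|('C_G[a * b] :&: C)%g|.

(* The vector space with basis C is 'rV[K]_#|C|: the i-th vector of the
   canonical basis stands for the element enum_val i of C. *)
Definition killing_form (u v : 'rV[K]_#|C|) : K :=
  \sum_(i < #|C|) \sum_(j < #|C|)
    u 0 i * v 0 j * (killing_coef (enum_val i) (enum_val j))%:R.

(* The matrix (K_C(a, b)) for a, b in C. *)
Definition killing_mx : 'M[K]_#|C| :=
  \matrix_(i < #|C|, j < #|C|) killing_form (delta_mx 0 i) (delta_mx 0 j).

Lemma killing_mxE i j :
  killing_mx i j = (killing_coef (enum_val i) (enum_val j))%:R.
Proof.
rewrite mxE /killing_form (bigD1 i) //= (bigD1 j) //= !mxE !eqxx !mul1r.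
rewrite [X in _ + X + _]big1 ?addr0 => [|k /negPf kj]; last first.
  by rewrite !mxE kj andbF mulr0 mul0r.
rewrite big1 ?addr0 // => k /negPf ki.
by rewrite big1 // => l _; rewrite !mxE ki andbF !mul0r.
Qed.

Definition killing_nondegenerate : Prop := killing_mx \in unitmx.

End KillingForm.

Definition real_set (gT : finGroupType) (C : {set gT}) : Prop :=
  forall x, x \in C -> (x^-1)%g \in C.

(* Main.v *)
Require Import Defs.
From mathcomp Require Import all_boot all_order all_algebra all_fingroup all_solvable.
From mathcomp Require Import complex reals ring.

Set Implicit Arguments.
Unset Strict Implicit.
Unset Printing Implicit Defensive.

Import GRing.Theory Num.Theory.

(** One has $K(a, b^{-1}) = \#\{c \in C : c^a = c^b\}$. As $C$ is real, the Killing form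
    of $C$ is, after the permutation $b \mapsto b^{-1}$ of the columns, the Gram
    matrix of the permutation operators by which the elements of $C$ act on the
    space with basis $C$. So it is non-degenerate if and only if these operators
    are linearly independent. A vector $v$ is a relation between them when, for all
    $x \in C$, the sum of $v$ over the part in $C$ of every coset $C_G(x)a$ vanishes
    ([balanced]). As conjugation acts transitively on $C$, one has to show that
    $v_a = 0$ for one element $a$ of $C$, which may be chosen at will.

    If some coset $C_G(x)a$ with $x \in C$ meets $C$ in $a$ only, then $v_a = 0$ at
    once ([balanced_isolated]). If it meets $C$ in $a$ and $a'$ only, then
    $v_{a'} = -v_a$; when $a' = a^r$ with $r^3 = 1$, three such equations along the
    triangle $a, a^r, a^{r^2}$ give $v_a = -v_a$ ([balanced_triangle]).

    Represent $a$ and $x$ by matrices $A$ and $X$ of determinant one and trace $t$,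
    and let $z = tr(XA)$. For $t \ne 0$ the coset is the conic of matrices
    $(\alpha + \beta X)A$ of determinant one, and its intersection with $C$ lies on
    the line $\alpha t + \beta z = t$ ([coset_class_span]). One common point is $A$;
    there is no other one if exactly one of the equations $t^2 = 2z$ and
    $z^2 - t^2z + t^2 = 0$ holds ([balanced_tangent]). By
    [conj_of_trace], matrices of determinant one and trace $t \ne \pm 2$ are
    conjugate, which leaves much freedom in the choice of $X$.
    - For odd $q$ and $t \ne 0, \pm 2$ there is $X$ with $z = t^2/2$.
    - For even $q$ and $A$ split there is $X$ with $z^2 + t^2z + t^2 = 0$.
    - For even $q$ and $A$ unipotent, where $t = 0$, any conjugate $X$ which does not
      commute with $A$ will do.
    - For odd $q$ and $t = 0$, elements of the class are half turns of the space of
      traceless matrices. If $z \ne 0$, the coset contains another one only if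
      $4 - z^2$ is a square. As $q > 3$, this can be avoided.
    - For even $q$ and $A$ non-split, and for odd $q$ and $A$ unipotent, a matrix $R$
      of order three is exhibited for which $R^{-1}ARA^{-1}$ is in the field or
      algebra generated by some $X$ conjugate to $A$. In the second case this
      requires a square root of $-1$, which exists because $C$ is real. *)

(** * Balanced functions on a conjugacy class *)

Section Balanced.
Variables (L : numClosedFieldType) (gT : finGroupType).
Local Open Scope ring_scope.

(** This is the relation $\sum_a v_a Ad_a = 0$ between the permutation operators
    $Ad_a$ of conjugation by the elements $a$ of [C] on the space with basis [C],
    read off entry by entry. *)
Definition balanced (C : {set gT}) (v : gT -> L) :=
  forall x y, x \in C -> \sum_(a in C | (x ^ a)%g == y) v a = 0.

Variables (G : {group gT}) (C : {set gT}).
Hypothesis sCG : C \subset G.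

(** [c] commutes with $ab^{-1}$ exactly when $c^a = c^b$: this turns the
    Killing form into a Gram matrix. *)
Lemma killing_coefV a b :
  killing_coef G C a b^-1 = #|[set c in C | (c ^ a)%g == (c ^ b)%g]|.
Proof.
apply: eq_card => c; rewrite 2!in_setI [RHS]inE andbC.
case Cc: (c \in C) => //=; rewrite (subsetP sCG) //=.
apply/cent1P/eqP => [/commgP/conjg_fixP | eq_c].
  by rewrite conjgM => /(canRL (conjgKV b)).
by apply/commgP/conjg_fixP; rewrite conjgM eq_c conjgK.
Qed.

Hypothesis nCG : {in C & G, forall x g, (x ^ g)%g \in C}.

(** Since [C] is stable under inversion, a vector $v$ in the kernel of the Killing
    form satisfies $\sum_{a, b} v_a \bar v_b K(a, b^{-1}) = 0$. This sum equals
    $\sum_{x, y} |S_{xy}|^2$, where $S_{xy}$ is the sum of $v_a$ over the $a$ with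
    $x^a = y$, so that all the $S_{xy}$ vanish. *)
Lemma killing_nondegenerate_balanced :
    real_set C -> (forall v, balanced C v -> {in C, forall a, v a = 0}) ->
  killing_nondegenerate L G C.
Proof.
move=> realC inj; rewrite /killing_nondegenerate -row_free_unit.
rewrite -kermx_eq0; apply/rowV0P => u /sub_kermxP u0.
have [C0 | [a0 Ca0]] := set_0Vmem C.
  by apply/rowP => i; have := enum_valP i; move/setP: C0 => ->; rewrite inE.
pose v (a : gT) := u 0 (enum_rank_in Ca0 a).
have vE i : v (enum_val i) = u 0 i by rewrite /v enum_valK_in.
have sumC (f : gT -> L) : \sum_(a in C) f a = \sum_(i < #|C|) f (enum_val i).
  by rewrite big_enum_val.
have ker b : b \in C -> \sum_(a in C) v a * (killing_coef G C a b)%:R = 0.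
  move=> Cb; have := congr1 (fun m : 'rV_#|C| => m 0 (enum_rank_in Ca0 b)) u0.
  rewrite !mxE => u0b; rewrite sumC -[RHS]u0b; apply: eq_bigr => i _.
  by rewrite killing_mxE enum_rankK_in // vE.
pose S x y := \sum_(a in C | (x ^ a)%g == y) v a.
have gram : \sum_(x in C) \sum_(y in C) S x y * (S x y)^* = 0.
  transitivity (\sum_(b in C) (v b)^* *
      \sum_(a in C) v a * (killing_coef G C a b^-1)%:R); last first.
    by rewrite big1 // => b Cb; rewrite ker ?mulr0 //; apply: realC.
  transitivity (\sum_(x in C) \sum_(b in C) \sum_(a in C)
     (v b)^* * v a * ((x ^ a)%g == (x ^ b)%g)%:R).
    apply: eq_bigr => x Cx; transitivity (\sum_(y in C) \sum_(b in C)
      \sum_(a in C) (v b)^* * v a * ((x ^ a == y) && (x ^ b == y))%g%:R).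
      apply: eq_bigr => y Cy; rewrite mulrC rmorph_sum /= mulr_suml.
      rewrite big_mkcondr; apply: eq_bigr => b Cb.
      rewrite mulr_sumr; case: ifP => _; last first.
        by rewrite big1 // => a _; rewrite andbF mulr0.
      rewrite big_mkcondr; apply: eq_bigr => a Ca.
      by case: eqP; rewrite ?mulr1 ?mulr0.
    rewrite exchange_big; apply: eq_bigr => b Cb /=.
    rewrite exchange_big; apply: eq_bigr => a Ca /=.
    rewrite -mulr_sumr; congr (_ * _).
    rewrite (bigD1 (x ^ b)%g) ?nCG ?(subsetP sCG) //= eqxx andbT.
    rewrite big1 ?addr0 // => y /andP[_ /negPf y_b].
    by rewrite [(x ^ b)%g == y]eq_sym y_b andbF.
  rewrite exchange_big; apply: eq_bigr => b Cb /=.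
  rewrite exchange_big mulr_sumr; apply: eq_bigr => a Ca /=.
  rewrite mulrA -mulr_sumr killing_coefV -sum1_card natr_sum; congr (_ * _).
  rewrite [RHS](eq_bigl (fun x => (x \in C) && (x ^ a == x ^ b)%g)).
    by rewrite [RHS]big_mkcondr; apply: eq_bigr => x _; case: eqP.
  by move=> x; rewrite inE.
have nonneg x y : 0 <= S x y * (S x y)^* by apply: mul_conjC_ge0.
have vbal : balanced C v.
  move=> x y Cx; case Cy: (y \in C); last first.
    rewrite big_pred0 // => a; apply: contraFF Cy => /andP[Ca /eqP <-].
    by rewrite nCG ?(subsetP sCG).
  have Sx := psumr_eq0P (fun x _ => sumr_ge0 _ (fun y _ => nonneg x y)) gram.
  have /eqP := psumr_eq0P (fun y _ => nonneg x y) (Sx x Cx) Cy.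
  by rewrite mul_conjC_eq0 => /eqP.
by apply/rowP => i; rewrite -vE mxE inj ?enum_valP.
Qed.

Lemma balancedJ v g : g \in G -> balanced C v -> balanced C (fun a => v (a ^ g)%g).
Proof.
move=> Gg bal x y Cx; rewrite -[RHS](bal (x ^ g)%g (y ^ g)%g) ?nCG //.
rewrite [RHS](reindex_inj (conjg_inj g)) /=; apply: eq_bigl => a.
rewrite -conjJg (inj_eq (conjg_inj g)); congr (_ && _).
apply/idP/idP => Ca; first exact: nCG.
by rewrite -(conjgK g a) nCG ?groupV.
Qed.

Lemma balanced_isolated v a x :
    balanced C v -> x \in C -> a \in C ->
    {in C, forall b, x ^ b = x ^ a -> b = a}%g ->
  v a = 0.
Proof.
move=> bal Cx Ca iso; rewrite -(bal x (x ^ a)%g Cx) (bigD1 a) ?Ca ?eqxx //=.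
rewrite big1 ?addr0 // => b /andP[/andP[Cb /eqP/(iso _ Cb) ->]].
by rewrite eqxx.
Qed.

Lemma balanced_pair v a a' x :
    balanced C v -> x \in C -> a \in C -> a' \in C -> a' != a ->
    (x ^ a' = x ^ a)%g ->
    {in C, forall b, x ^ b = x ^ a -> b = a \/ b = a'}%g ->
  v a + v a' = 0.
Proof.
move=> bal Cx Ca Ca' na xa' iso; rewrite -(bal x (x ^ a)%g Cx).
rewrite (bigD1 a) ?Ca ?eqxx //= (bigD1 a') ?Ca' ?xa' ?eqxx //= big1 ?addr0 //.
by move=> b /andP[/andP[/andP[Cb /eqP/(iso _ Cb) []->]]]; rewrite eqxx.
Qed.

(** Conjugating by [r] turns the pair [(a, a ^ r)] into two further pairs, which
    close up into a triangle; around a cycle of odd length the sign of [v]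
    cannot alternate. *)
Lemma balanced_triangle v a r x :
    balanced C v -> x \in C -> a \in C -> r \in G -> (r ^+ 3 = 1)%g ->
    (a ^ r != a)%g -> (x ^ (a ^ r) = x ^ a)%g ->
    {in C, forall b, x ^ b = x ^ a -> b = a \/ b = a ^ r}%g ->
  v a = 0.
Proof.
move=> bal Cx Ca Gr r3 na xa iso.
have pair w : balanced C w -> w a + w (a ^ r)%g = 0.
  have Car : (a ^ r)%g \in C by apply: nCG.
  by move=> balw; apply: (balanced_pair balw Cx Ca Car na xa iso).
have e1 := pair v bal.
have e2 := pair _ (balancedJ Gr bal).
have e3 := pair _ (balancedJ Gr (balancedJ Gr bal)); rewrite /= in e2 e3.
have a3 : (((a ^ r) ^ r) ^ r = a)%g by rewrite -!conjgM -expg2 -expgS r3 conjg1.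
rewrite a3 in e3.
have /eqP : v a *+ 2 = 0.
  have -> : v a *+ 2 = (v a + v (a ^ r)%g) - (v (a ^ r)%g + v ((a ^ r) ^ r)%g)
      + (v ((a ^ r) ^ r)%g + v a) by ring.
  by rewrite e1 e2 e3; ring.
by rewrite mulrn_eq0 => /eqP.
Qed.

End Balanced.

(** Conjugation preserves the kernel of the Killing form and moves any entry of
    a vector to any other, so that a single entry has to be examined. *)
Lemma killing_nondegenerate_class (L : numClosedFieldType) (gT : finGroupType)
    (G : {group gT}) (a : gT) :
    a \in G -> real_set (a ^: G)%g ->
    (forall v : gT -> L, balanced (a ^: G)%g v -> v a = 0%R) ->
  killing_nondegenerate L G (a ^: G)%g.
Proof.
move=> Ga realC va; have sCG : (a ^: G)%g \subset G by rewrite class_subG.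
have nCG : {in (a ^: G)%g & G, forall x g, x ^ g \in a ^: G}%g.
  by move=> _ g /imsetP[h Gh ->] Gg; rewrite -conjgM; apply/memJ_class/groupM.
apply: killing_nondegenerate_balanced => // v bal _ /imsetP[g Gg ->].
exact: va (balancedJ nCG Gg bal).
Qed.

(** * Two by two matrices *)

Section TwoByTwo.
Variable F : fieldType.
Local Open Scope ring_scope.
Implicit Types (A B M X H P : 'M[F]_2) (a b c d t : F).

Definition mx2 a b c d : 'M[F]_2 := \matrix_(i, j)
  if i == 0 then if j == 0 then a else b else if j == 0 then c else d.

Lemma mx2_eta A : A = mx2 (A 0 0) (A 0 1) (A 1 0) (A 1 1).
Proof.
apply/matrixP => i j; rewrite mxE.
by case: i j => [[|[|i]] lti] [[|[|j]] ltj] //=; congr (A _ _); apply: val_inj.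
Qed.

Lemma mx2_inj a b c d a' b' c' d' :
  mx2 a b c d = mx2 a' b' c' d' -> [/\ a = a', b = b', c = c' & d = d'].
Proof.
move=> /matrixP E.
by split; [have := E 0 0 | have := E 0 1 | have := E 1 0 | have := E 1 1];
  rewrite !mxE.
Qed.

Lemma mx2M a b c d a' b' c' d' : mx2 a b c d * mx2 a' b' c' d' =
  mx2 (a * a' + b * c') (a * b' + b * d') (c * a' + d * c') (c * b' + d * d').
Proof.
rewrite [LHS]mx2_eta /GRing.mul /= !mxE !big_ord_recl !big_ord0 !mxE /=.
by rewrite !addr0.
Qed.

Lemma mx2D a b c d a' b' c' d' :
  mx2 a b c d + mx2 a' b' c' d' = mx2 (a + a') (b + b') (c + c') (d + d').
Proof. by rewrite [LHS]mx2_eta !mxE. Qed.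

Lemma mx2N a b c d : - mx2 a b c d = mx2 (- a) (- b) (- c) (- d).
Proof. by rewrite [LHS]mx2_eta !mxE. Qed.

Lemma mx2Z t a b c d : t *: mx2 a b c d = mx2 (t * a) (t * b) (t * c) (t * d).
Proof. by rewrite [LHS]mx2_eta !mxE. Qed.

Lemma mx2_scalar t : t%:M = mx2 t 0 0 t.
Proof. by rewrite [LHS]mx2_eta !mxE. Qed.

Lemma det_mx2 a b c d : \det (mx2 a b c d) = a * d - b * c.
Proof.
rewrite (expand_det_row _ 0) !big_ord_recl big_ord0 /cofactor !det_mx11 !mxE /=.
by rewrite addr0 expr0 expr1 mul1r mulN1r mulrN.
Qed.

Lemma tr_mx2 a b c d : \tr (mx2 a b c d) = a + d.
Proof. by rewrite /mxtrace !big_ord_recl big_ord0 !mxE addr0. Qed.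

Definition mx2E := (mx2M, mx2D, mx2N, mx2Z, mx2_scalar, det_mx2, tr_mx2).

Lemma mx2_1 : 1 = mx2 1 0 0 1.
Proof. exact: mx2_scalar. Qed.

Lemma det1_unit A : \det A = 1 -> A \is a GRing.unit.
Proof. by move=> dA; rewrite unitmxE dA unitr1. Qed.

Lemma det1V a b c d : \det (mx2 a b c d) = 1 ->
  (mx2 a b c d)^-1 = mx2 d (- b) (- c) a.
Proof.
move=> dA; apply: (mulrI (det1_unit dA)); rewrite divrr ?det1_unit //.
move: dA; rewrite !mx2E => dA; rewrite mx2_1.
by congr mx2; rewrite -?dA; ring.
Qed.

End TwoByTwo.

(** * Matrices representing elements of the projective group *)

Section ProjectiveSpecialLinear.
Variable F : finFieldType.
Local Open Scope ring_scope.
Implicit Types (A B M X H P : 'M[F]_2).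

Definition gl2 A : {'GL_2[F]} := insubd (1%g : {'GL_2[F]}) A.

Definition psl A : coset_of 'Z(SL 2 F) := coset 'Z(SL 2 F) (gl2 A).

Lemma GLval_inj : injective (GLval : {'GL_2[F]} -> 'M[F]_2).
Proof. exact: val_inj. Qed.

Lemma gl2K A : \det A = 1 -> GLval (gl2 A) = A.
Proof. by move=> dA; rewrite [LHS]insubdK //; apply: det1_unit. Qed.

Lemma gl2M A B : \det A = 1 -> \det B = 1 -> gl2 (A * B) = (gl2 A * gl2 B)%g.
Proof.
by move=> dA dB; apply: GLval_inj; rewrite GL_ME !gl2K // det_mulmx dA dB mulr1.
Qed.

Lemma gl2_SL A : \det A = 1 -> gl2 A \in SL 2 F.
Proof. by move=> dA; rewrite inE gl2K // dA. Qed.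

Lemma SL_norm_center : SL 2 F \subset 'N('Z(SL 2 F))%g.
Proof. exact/normal_norm/center_normal. Qed.

Lemma psl_PSL A : \det A = 1 -> psl A \in PSL 2 F.
Proof. by move=> dA; apply/mem_quotient/gl2_SL. Qed.

Lemma pslM A B : \det A = 1 -> \det B = 1 -> psl (A * B) = (psl A * psl B)%g.
Proof.
move=> dA dB; rewrite /psl gl2M // morphM //;
  exact/(subsetP SL_norm_center)/gl2_SL.
Qed.

Lemma psl1 : psl 1 = 1%g.
Proof.
rewrite /psl (_ : gl2 1 = 1%g) ?morph1 //.
by apply: GLval_inj; rewrite gl2K ?det1.
Qed.

Lemma det1_inv A : \det A = 1 -> \det A^-1 = 1.
Proof. by move=> dA; rewrite -[A^-1]/(invmx A) det_inv dA invr1. Qed.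

Lemma pslV A : \det A = 1 -> psl A^-1 = (psl A)^-1%g.
Proof.
move=> dA; apply/eqP; rewrite eq_sym eq_invg_mul -pslM ?det1_inv //.
by rewrite divrr ?psl1 // det1_unit.
Qed.

Lemma pslJ A P : \det A = 1 -> \det P = 1 ->
  psl (P^-1 * A * P) = (psl A ^ psl P)%g.
Proof.
move=> dA dP; rewrite !pslM ?det1_inv //; last first.
  by rewrite det_mulmx det1_inv // dA mulr1.
by rewrite pslV // conjgE mulgA.
Qed.

Lemma PSL_lift b : b \in PSL 2 F -> exists2 B, \det B = 1 & b = psl B.
Proof.
case/morphimP => u _ Su ->; exists (GLval u); first by move: Su; rewrite inE => /eqP.
by congr (coset _ _); apply: GLval_inj; rewrite gl2K //; move: Su; rewrite inE => /eqP.
Qed.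

(** The centre consists of the scalars $\pm 1$: commuting with the two
    elementary transvections forces a matrix to be scalar. *)
Lemma center_SL2 (u : {'GL_2[F]}) :
  (u \in 'Z(SL 2 F)%g) = (GLval u == 1) || (GLval u == - 1).
Proof.
apply/idP/idP => [/centerP[Su comu] | uE].
  have dU : \det (mx2 1 1 0 1 : 'M[F]_2) = 1 by rewrite det_mx2; ring.
  have dL : \det (mx2 1 0 1 1 : 'M[F]_2) = 1 by rewrite det_mx2; ring.
  have := congr1 GLval (comu _ (gl2_SL dL)); have := congr1 GLval (comu _ (gl2_SL dU)).
  move: Su; rewrite inE !GL_ME !gl2K // [GLval u]mx2_eta.
  move: (GLval u 0 0) (GLval u 0 1) (GLval u 1 0) (GLval u 1 1) => a b c d.
  rewrite !mx2M det_mx2 => /eqP du /mx2_inj[e1 e2 _ _] /mx2_inj[e3 _ _ _].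
  have c0 : c = 0.
    by apply: (addrI a); transitivity (a * 1 + b * 0); [rewrite e1|]; ring.
  have b0 : b = 0.
    by apply: (addrI a); transitivity (a * 1 + b * 1); [|rewrite e3]; ring.
  have da : d = a.
    by apply: (addIr b); transitivity (a * 1 + b * 1); [rewrite e2|]; ring.
  move: du; rewrite b0 c0 da mul0r subr0 -expr2 => /eqP.
  by rewrite sqrf_eq1 mx2_1 mx2N oppr0 => /orP[]/eqP->; rewrite eqxx ?orbT.
have sc : exists2 t, GLval u = t%:M & t * t = 1.
  by case/orP: uE => /eqP->; [exists 1 | exists (- 1)];
    rewrite ?mulrNN ?mulr1 ?raddfN.
case: sc => t ut t2; apply/centerP; split.
  by rewrite inE ut det_scalar expr2 t2.
by move=> v _; apply: GLval_inj; rewrite !GL_ME ut; apply/esym/scalar_mxC.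
Qed.

Lemma psl_eqP A B : \det A = 1 -> \det B = 1 ->
  psl A = psl B <-> A = B \/ A = - B.
Proof.
move=> dA dB; have nA := subsetP SL_norm_center _ (gl2_SL dA).
have nB := subsetP SL_norm_center _ (gl2_SL dB).
have -> : psl A = psl B <-> gl2 A \in ('Z(SL 2 F) :* gl2 B)%g.
  by split=> /(rcoset_kercosetP nA nB).
rewrite mem_rcoset center_SL2 GL_ME GL_VE !gl2K //.
split=> [/orP[]/eqP AB | [|] ->].
- by left; rewrite -[A](mulrVK (det1_unit dB)) AB mul1r.
- by right; rewrite -[A](mulrVK (det1_unit dB)) AB mulN1r.
- by rewrite divrr ?det1_unit // eqxx.
by rewrite mulNr divrr ?det1_unit // eqxx orbT.
Qed.

End ProjectiveSpecialLinear.

(** * Conjugacy in the special linear group *)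

Section Companion.
Variable F : fieldType.
Local Open Scope ring_scope.
Implicit Types (A B M X H P : 'M[F]_2).

(** This is the area of the parallelogram spanned by the vector $w = (u, v)$ and
    its image $Aw$. *)
Definition area_form A (u v : F) :=
  A 1 0 * u ^+ 2 + (A 1 1 - A 0 0) * u * v - A 0 1 * v ^+ 2.

Lemma area_form_mx2 a b c d u v : area_form (mx2 a b c d) u v =
  c * u ^+ 2 + (d - a) * u * v - b * v ^+ 2.
Proof. by rewrite /area_form !mxE. Qed.

(** The columns of [P] are $w = (u, v)$ and $Aw / k$, where $k$ is the area:
    dividing by it makes [P] unimodular. *)
Lemma companion_conj A u v :
    \det A = 1 -> area_form A u v != 0 ->
  exists2 P, \det P = 1 &
    A * P = P * mx2 0 (- (area_form A u v)^-1) (area_form A u v) (\tr A).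
Proof.
rewrite [A]mx2_eta; move: (A 0 0) (A 0 1) (A 1 0) (A 1 1) => a b c d.
rewrite area_form_mx2 det_mx2 tr_mx2; set k := (X in X != 0) => detA k0.
exists (mx2 u ((a * u + b * v) / k) v ((c * u + d * v) / k)).
  by rewrite det_mx2 -[RHS](divff k0) /k; ring.
rewrite !mx2M; congr mx2; apply/subr0_eq.
- by rewrite mulr0 add0r divfK // subrr.
- transitivity (u * k^-1 * (1 - (a * d - b * c))); first by ring.
  by rewrite detA subrr mulr0.
- by rewrite mulr0 add0r divfK // subrr.
transitivity (v * k^-1 * (1 - (a * d - b * c))); first by ring.
by rewrite detA subrr mulr0.
Qed.

(** Both matrices are conjugate to the same companion matrix. In contrast with
    conjugacy in the general linear group, the areas have to match. *)
Lemma conj_of_area A B u v u' v' :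
    \det A = 1 -> \det B = 1 -> \tr A = \tr B ->
    area_form A u v != 0 -> area_form A u v = area_form B u' v' ->
  exists2 P, \det P = 1 & P^-1 * A * P = B.
Proof.
move=> dA dB tAB kA kAB; have kB : area_form B u' v' != 0 by rewrite -kAB.
have [P dP eP] := companion_conj dA kA; have [Q dQ eQ] := companion_conj dB kB.
have [uP uQ] := (det1_unit dP, det1_unit dQ).
exists (P * Q^-1).
  by rewrite det_mulmx dP mul1r -[Q^-1]/(invmx Q) det_inv dQ invr1.
rewrite invrM ?unitrV // invrK -!mulrA (mulrA A) eP kAB tAB -mulrA mulKr //.
by rewrite mulrA -eQ mulrK.
Qed.

End Companion.

(** * Squares and binary quadratic forms over a finite field *)

Section FiniteField.
Variable F : finFieldType.
Local Open Scope ring_scope.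

Lemma card_imset_fiber2 (f g : F -> F) (D : {set F}) :
    {in D &, forall x y, f x = f y -> y = x \/ y = g x} ->
  (#|D| <= 2 * #|f @: D|)%N.
Proof.
move=> fib; rewrite -sum1_card (partition_big_imset f) /= mulnC -sum_nat_const.
apply: leq_sum => _ /imsetP[x Dx ->]; rewrite sum1dep_card.
apply: leq_trans (_ : #|[set x; g x]| <= 2)%N; last first.
  by rewrite cards2; case: (_ != _).
apply/subset_leq_card/subsetP => y; rewrite !inE => /andP[Dy /eqP/esym].
by case/(fib _ _ Dx Dy) => ->; rewrite eqxx ?orbT.
Qed.

Lemma exists_notin (s : seq F) : (size s < #|F|)%N -> exists x, x \notin s.
Proof.
move=> sF; apply/existsP; rewrite -negb_forall; apply: contraL sF => /forallP alls.
rewrite -leqNgt; apply: leq_trans (card_size s).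
by apply: subset_leq_card; apply/subsetP => x _; apply: alls.
Qed.

Lemma char2_eqN (x : F) : 2%:R = 0 :> F -> - x = x.
Proof.
move=> c2; apply/eqP; rewrite eq_sym -subr_eq0 opprK.
by rewrite -mulr2n -mulr_natl c2 mul0r.
Qed.

Lemma char2_sqrt (x : F) : 2%:R = 0 :> F -> exists y, y ^+ 2 = x.
Proof.
move=> c2; have inj : injective (fun y : F => y ^+ 2).
  by move=> y z /eqP; rewrite eqf_sqr char2_eqN // orbb => /eqP.
by exists (invF inj x); apply: (f_invF inj).
Qed.

(** The values of $ax^2$ and of $c - by^2$ each fill more than half of the
    field. *)
Lemma diagonal_form_surj (a b c : F) :
    2%:R != 0 :> F -> a != 0 -> b != 0 ->
  exists x y, a * x ^+ 2 + b * y ^+ 2 = c.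
Proof.
move=> c2 a0 b0.
pose S : {set F} := 0 |: (fun x : F => x ^+ 2) @: [set~ 0].
have sqS x : x \in S -> exists y, x = y ^+ 2.
  by rewrite !inE => /orP[/eqP->|/imsetP[y _ ->]]; [exists 0; rewrite expr0n|exists y].
have cardS : (#|F| < 2 * #|S|)%N.
  rewrite cardsU1 (_ : 0 \notin _) /=; last first.
    apply/imsetP => -[x]; rewrite !inE => x0 /esym/eqP.
    by rewrite sqrf_eq0 (negPf x0).
  rewrite mulnDr muln1 addSn ltnS.
  have := @card_imset_fiber2 (fun x => x ^+ 2) -%R [set~ 0].
  have F0 : (0 < #|F|)%N by apply/card_gt0P; exists 0.
  rewrite cardsC1 -(prednK F0) add1n ltnS; apply=> x y _ _ /eqP.
  by rewrite eqf_sqr => /orP[]/eqP->; [left | right; rewrite opprK].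
pose f x := a * x; pose g x := c - b * x.
have inj_f : injective f by apply: mulfI.
have inj_g : injective g by move=> x y /addrI/oppr_inj/(mulfI b0).
have [dis|[z]] := set_0Vmem (f @: S :&: g @: S).
  have := max_card (f @: S :|: g @: S); rewrite cardsU dis cards0 subn0.
  by rewrite !card_imset // addnn -mul2n leqNgt cardS.
rewrite inE => /andP[/imsetP[x /sqS[r ->] ->]].
case/imsetP => y /sqS[s ->] e; exists r, s.
by rewrite [_ * r ^+ 2]e subrK.
Qed.

(** The argument is completion of the square; in characteristic two, where it
    fails, all elements are squares already. *)
Lemma binary_form_surj (a b c k : F) :
    b ^+ 2 - 4%:R * a * c != 0 ->
  exists u v, a * u ^+ 2 + b * u * v + c * v ^+ 2 = k.
Proof.
move=> disc; have [a0|a0] := eqVneq a 0.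
  have b0 : b != 0.
    by apply: contraNneq disc => ->; rewrite a0 mulr0 mul0r subr0 expr0n.
  exists ((k - c) / b), 1; rewrite a0 mul0r add0r !mulr1 expr1n mulr1.
  by rewrite mulrC divfK // subrK.
have [c2|c2] := eqVneq (2%:R : F) 0.
  have [u uE] := char2_sqrt (k / a) c2; exists u, 0.
  by rewrite uE expr0n !mulr0 !addr0 mulrC divfK.
have [|x [v e]] := @diagonal_form_surj 1 (- (b ^+ 2 - 4%:R * a * c))
  (4%:R * a * k) c2 (oner_neq0 _); first by rewrite oppr_eq0.
exists ((x - b * v) / (2%:R * a)), v.
apply: (mulfI (_ : 4%:R * a != 0)).
  by rewrite mulf_neq0 // (natrM _ 2 2) mulf_neq0.
by rewrite -e; field; rewrite a0 c2.
Qed.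

(** If $1 - t^2$ were always a square, the squares would be closed under
    products and under differences $v - u = v(1 - u/v)$, $v \ne 0$. Since
    $x = ((x+1)/2)^2 - ((x-1)/2)^2$, every $x \ne -1$ would be a square, and so
    would $-1 = -x/x$ for any $x$ other than $0, 1, -1$. But squaring is not
    injective, hence not surjective. *)
Lemma exists_one_sub_sqr_nonsquare :
    2%:R != 0 :> F -> (4 <= #|F|)%N ->
  exists t : F, forall s, 1 - t ^+ 2 != s ^+ 2.
Proof.
move=> c2 F4; pose sq (x : F) := [exists y, x == y ^+ 2].
have sqP x : reflect (exists y, x = y ^+ 2) (sq x) by apply: exists_eqP.
have [/existsP[t /forallP tE]|/existsPn all_t] :=
  boolP [exists t : F, [forall s : F, 1 - t ^+ 2 != s ^+ 2]]; first by exists t.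
have sq1B x : sq x -> sq (1 - x).
  case/sqP => t ->; have := all_t t; rewrite negb_forall.
  by case/existsP => s; rewrite negbK => /eqP e; apply/sqP; exists s.
have sqM x y : sq x -> sq y -> sq (x * y).
  by move=> /sqP[s ->] /sqP[t ->]; apply/sqP; exists (s * t); rewrite exprMn.
have sqV x : sq x -> sq x^-1.
  by move=> /sqP[s ->]; apply/sqP; exists s^-1; rewrite exprVn.
have sqB x y : y != 0 -> sq x -> sq y -> sq (y - x).
  move=> y0 sx sy; rewrite (_ : y - x = y * (1 - x / y)); last by field.
  by rewrite sqM ?sq1B ?sqM ?sqV.
have sq_neqN1 x : x != -1 -> sq x.
  move=> xN1; rewrite (_ : x = ((x + 1) / 2%:R) ^+ 2 - ((x - 1) / 2%:R) ^+ 2).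
    apply: sqB; [|by apply/sqP; eexists..].
    by rewrite expf_neq0 // mulf_neq0 ?invr_eq0 // addr_eq0.
  by field.
have [x] := @exists_notin [:: 0; 1; -1] F4.
rewrite !inE !negb_or => /and3P[x0 x1 xN1].
have sqN1 : sq (-1).
  rewrite (_ : -1 = - x * x^-1); last by rewrite mulNr divff.
  by rewrite sqM ?sqV ?sq_neqN1 // eqr_opp.
have [inv invE] : exists g : F -> F, cancel g (fun x => x ^+ 2).
  apply: (@fin_all_exists _ _ (fun x y => y ^+ 2 = x)) => y.
  have /sqP[z ->] : sq y by have [->|/sq_neqN1] := eqVneq y (-1).
  by exists z.
have := canF_RL invE; have invK : cancel (fun x : F => x ^+ 2) inv by apply: canF_sym.
have : 1 = -1 :> F by apply: (can_inj invK); rewrite sqrrN.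
by move/eqP; rewrite -subr_eq0 opprK (negPf c2).
Qed.

(** * Artin-Schreier values in characteristic two *)

Definition artin_schreier (x : F) := [exists y, y ^+ 2 + y == x].

Section CharacteristicTwo.
Hypothesis c2 : 2%:R = 0 :> F.

Lemma char2_eq (k x y : F) : x = y + 2%:R * k -> x = y.
Proof. by rewrite c2 mul0r addr0. Qed.

Lemma char2_addK (x y : F) : x + y + y = x.
Proof. by apply: (@char2_eq y); ring. Qed.

Lemma artin_schreierP x :
  reflect (exists y, y ^+ 2 + y = x) (artin_schreier x).
Proof. exact: exists_eqP. Qed.

Lemma artin_schreierD x y :
  artin_schreier x -> artin_schreier y -> artin_schreier (x + y).
Proof.
move=> /artin_schreierP[s <-] /artin_schreierP[t <-].
by apply/artin_schreierP; exists (s + t); apply: (@char2_eq (s * t)); ring.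
Qed.

Lemma artin_schreierDl x y :
  artin_schreier x -> artin_schreier (x + y) = artin_schreier y.
Proof.
move=> Wx; apply/idP/idP => [|Wy]; last exact: artin_schreierD.
by move/(artin_schreierD Wx); rewrite addrA addrC addrA char2_addK.
Qed.

Lemma artin_schreier_sqr x : artin_schreier (x ^+ 2) = artin_schreier x.
Proof.
rewrite -(@artin_schreierDl (x ^+ 2 + x) x).
  by congr artin_schreier; rewrite char2_addK.
by apply/artin_schreierP; exists x.
Qed.

(** The additive map $y \mapsto y^2 + y$ has kernel $\{0, 1\}$, so that its
    image has index two. *)
Lemma artin_schreierDN x y :
  ~~ artin_schreier x -> ~~ artin_schreier y -> artin_schreier (x + y).
Proof.
move=> nx ny; apply: contraT => nxy.
pose W : {set F} := [set y ^+ 2 + y | y in [set: F]].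
have WE z : (z \in W) = artin_schreier z.
  apply/imsetP/artin_schreierP => [[t _ ->]|[t <-]]; exists t => //.
have cardW : (#|F| <= 2 * #|W|)%N.
  rewrite -cardsT; apply: (@card_imset_fiber2 _ (fun y => y + 1)).
  move=> s t _ _ e.
  have : (t - s) * (t - s + 1) = 0.
    transitivity ((t ^+ 2 + t) - (s ^+ 2 + s)); last by rewrite e subrr.
    by apply: (@char2_eq (s ^+ 2 - s * t)); ring.
  move/eqP; rewrite mulf_eq0 subr_eq0 => /orP[/eqP->|]; first by left.
  rewrite -subr_eq0 => /eqP st; right; apply/subr0_eq.
  by rewrite -[RHS]st; apply: (@char2_eq (-1)); ring.
pose W' := [set x + w | w in W].
have W'E z : z \in W' -> artin_schreier (x + z).
  case/imsetP => w; rewrite WE => Ww ->.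
  by rewrite addrC [x + w]addrC char2_addK.
have disj : W :&: W' = set0.
  apply/setP => z; rewrite !inE WE; apply/negP => /andP[Wz /W'E].
  by rewrite addrC artin_schreierDl // (negPf nx).
have := subset_leq_card (subsetT (y |: (W :|: W'))).
rewrite cardsT cardsU1 inE WE (negPf ny) /=.
rewrite (contraNN (@W'E y) nxy) /= cardsU disj cards0 subn0.
rewrite [#|W'|]card_imset; last exact: addrI.
by rewrite addnn -mul2n add1n ltnNge cardW.
Qed.

Lemma artin_schreier0 : artin_schreier 0.
Proof. by apply/artin_schreierP; exists 0; rewrite expr0n addr0. Qed.

(** If $1$ is of the form $y^2 + y$, then $e = \sqrt m + 1$ works, because $m$ and
    $\sqrt m$ differ by an element of that form. Otherwise, let $W$ be the set of
    these elements. If no $e$ existed, $w \mapsto m/w$ would preserve $W$ and its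
    complement. But exactly one of $y$, $y + 1$ is in $W$, so that for $y \ne 0, 1$
    $m/y + m/(y+1) = m/(y^2+y)$ would not be in $W$, although $y^2 + y$ is. *)
Lemma exists_artin_schreier_pair m : (4 <= #|F|)%N -> ~~ artin_schreier m ->
  exists2 e, ~~ artin_schreier e & ~~ artin_schreier (m / (e + 1)).
Proof.
move=> F4 nm; have m0 : m != 0 by apply: contraNneq nm => ->; apply: artin_schreier0.
case W1: (artin_schreier 1).
  have [h hm] := char2_sqrt m c2.
  have nh : ~~ artin_schreier h by rewrite -artin_schreier_sqr hm.
  have h0 : h != 0 by apply: contraNneq m0 => h0; rewrite -hm h0 expr0n.
  exists (h + 1); first by rewrite addrC artin_schreierDl.
  by rewrite char2_addK -hm expr2 mulfK.
have [/existsP[e /andP[]]|/existsPn none] :=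
  boolP [exists e, ~~ artin_schreier e && ~~ artin_schreier (m / (e + 1))].
  by exists e.
have Wdiv w : artin_schreier w -> artin_schreier (m / w).
  move=> Ww; have := none (w + 1).
  by rewrite artin_schreierDl // W1 /= negbK char2_addK.
have divW h : artin_schreier (m / h) -> artin_schreier h.
  have [->|h0 /Wdiv] := eqVneq h 0; first by rewrite artin_schreier0.
  by rewrite invf_div mulrC divfK.
have [y] := @exists_notin [:: 0; 1] (ltnW F4).
rewrite !inE negb_or => /andP[y0 y1].
have y10 : y + 1 != 0 by rewrite addr_eq0 char2_eqN.
have yW : artin_schreier (m / y + m / (y + 1)).
  rewrite (_ : _ + _ = m / (y ^+ 2 + y)).
    by apply: Wdiv; apply/artin_schreierP; exists y.
  apply: (@char2_eq (m * y / (y ^+ 2 + y))).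
  by field; rewrite y0 y10 -[X in _ + X]mulr1 -mulrDr mulf_neq0.
case Wy: (artin_schreier y).
  have := W1; rewrite -(artin_schreierDl _ Wy) (divW (y + 1)) //.
  by rewrite -(artin_schreierDl _ (Wdiv _ Wy)).
have Wy1 : artin_schreier (y + 1) by apply: artin_schreierDN; rewrite ?Wy ?W1.
have := Wy; rewrite (divW y) //.
by rewrite -(artin_schreierDl _ (Wdiv _ Wy1)) addrC.
Qed.

End CharacteristicTwo.
End FiniteField.

(** * Separating one element of a class by centralizer cosets *)

Section Criteria.
Variables (F : finFieldType) (L : numClosedFieldType).
Local Open Scope ring_scope.
Implicit Types (A B M X H P R : 'M[F]_2).

(** The area form of a matrix of determinant one and trace $t$ is a binary
    quadratic form of discriminant $t^2 - 4$, so that it represents $1$. *)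
Lemma conj_of_trace A B :
    \det A = 1 -> \det B = 1 -> \tr A = \tr B -> \tr A ^+ 2 != 4%:R ->
  exists2 P, \det P = 1 & P^-1 * A * P = B.
Proof.
have area1 M : \det M = 1 -> \tr M ^+ 2 != 4%:R -> exists u v, area_form M u v = 1.
  rewrite [M]mx2_eta; move: (M 0 0) (M 0 1) (M 1 0) (M 1 1) => a b c d.
  rewrite det_mx2 tr_mx2 => dM tM.
  have [|u [v e]] := @binary_form_surj F c (d - a) (- b) 1.
    rewrite (_ : _ - _ = (a + d) ^+ 2 - 4%:R * (a * d - b * c)); last by ring.
    by rewrite dM mulr1 subr_eq0.
  by exists u, v; rewrite area_form_mx2 -e; ring.
move=> dA dB tAB tA; have [u [v eA]] := area1 A dA tA.
have [u' [v' eB]] : exists u v, area_form B u v = 1 by apply: area1; rewrite -?tAB.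
by apply: (conj_of_area dA dB tAB (u := u) (v := v) (u' := u') (v' := v'));
   rewrite eA ?eB // oner_neq0.
Qed.

Lemma det_conj A P : \det A = 1 -> \det P = 1 -> \det (P^-1 * A * P) = 1.
Proof. by move=> dA dP; rewrite !det_mulmx det1_inv // dA dP !mulr1. Qed.

Lemma tr_conj A P : \det P = 1 -> \tr (P^-1 * A * P) = \tr A.
Proof.
move=> dP; rewrite -mulrA -[LHS]mxtrace_mulC.
by rewrite -[_ *m _]/(A * P * P^-1) mulrK ?det1_unit.
Qed.

Lemma mem_class_psl A B P : \det A = 1 -> \det P = 1 -> P^-1 * A * P = B ->
  psl B \in (psl A ^: PSL 2 F)%g.
Proof. by move=> dA dP <-; rewrite pslJ //; apply/memJ_class/psl_PSL. Qed.

Lemma class_psl_lift A b : \det A = 1 -> b \in (psl A ^: PSL 2 F)%g ->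
  exists B, [/\ \det B = 1, \tr B = \tr A & b = psl B].
Proof.
move=> dA /imsetP[g /PSL_lift[P dP ->] ->]; exists (P^-1 * A * P).
by rewrite det_conj ?tr_conj ?pslJ.
Qed.

Lemma conj_psl_eq A B X : \det A = 1 -> \det B = 1 -> \det X = 1 ->
  (psl X ^ psl B = psl X ^ psl A)%g <->
  (B * A^-1 * X = X * (B * A^-1) \/ B * A^-1 * X = - (X * (B * A^-1))).
Proof.
move=> dA dB dX; have [uA uB] := (det1_unit dA, det1_unit dB).
rewrite -!pslJ // psl_eqP ?det_conj //; split=> -[e|e].
- left; have := congr1 (fun M => B * M * A^-1) e.
  by rewrite !mulrA divrr // mul1r mulrK.
- right; have := congr1 (fun M => B * M * A^-1) e.
  rewrite mulrN mulNr !mulrA divrr // mul1r mulrK // => ->.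
  by rewrite opprK.
- left; apply: (mulIr (_ : A^-1 \is a GRing.unit)); first by rewrite unitrV.
  apply: (mulrI uB).
  by rewrite !mulrA mulrK // e divrr // mul1r !mulrA.
right; apply: (mulIr (_ : A^-1 \is a GRing.unit)); first by rewrite unitrV.
apply: (mulrI uB); rewrite mulNr mulrN.
by rewrite !mulrA mulrK // e opprK divrr // mul1r !mulrA.
Qed.

Lemma commute_span H X : H * X = X * H -> (forall t, X != t%:M) ->
  exists a b, H = a%:M + b *: X.
Proof.
rewrite [H]mx2_eta [X]mx2_eta; move: (X 0 0) (X 0 1) (X 1 0) (X 1 1) => p q r s.
move: (H 0 0) (H 0 1) (H 1 0) (H 1 1) => a b c d.
rewrite !mx2M => /mx2_inj[e1 e2 e3 _] nX.
have E1 : b * r = q * c by apply: (addrI (a * p)); rewrite e1; ring.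
have E2 : q * (a - d) = b * (p - s).
  by apply: (addIr (b * s + q * d)); transitivity (a * q + b * s); [|rewrite e2]; ring.
have E3 : r * (a - d) = c * (p - s).
  by apply: (addIr (r * d + s * c)); transitivity (r * a + s * c); [|rewrite -e3]; ring.
suff [be [adE bE cE]] : exists be, [/\ a - d = be * (p - s), b = be * q & c = be * r].
  exists (a - be * p), be; rewrite !mx2E; congr mx2; rewrite ?add0r //.
    by rewrite subrK.
  by rewrite -[d](subKr a) adE; ring.
have [ps|ps] := eqVneq (p - s) 0; last first.
  exists ((a - d) / (p - s)); split; first by rewrite divfK.
    by apply: (mulIf ps); rewrite -E2; field.
  by apply: (mulIf ps); rewrite -E3; field.
have [q0|q0] := eqVneq q 0; last first.
  exists (b / q); split; last by apply: (mulfI q0); rewrite -E1; field.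
    by apply: (mulfI q0); rewrite E2; field.
  by rewrite divfK.
have [r0|r0] := eqVneq r 0; last first.
  exists (c / r); split; last by rewrite divfK.
    by apply: (mulfI r0); rewrite E3; field.
  by apply: (mulIf r0); rewrite E1; field.
by have := nX s; rewrite q0 r0 (subr0_eq ps) mx2_scalar eqxx.
Qed.

Lemma det_span a b X : \det X = 1 ->
  \det (a%:M + b *: X) = a ^+ 2 + a * b * \tr X + b ^+ 2.
Proof.
rewrite [X]mx2_eta; move: (X 0 0) (X 0 1) (X 1 0) (X 1 1) => p q r s.
by rewrite !mx2E => dX; rewrite -[b ^+ 2]mulr1 -dX; ring.
Qed.

Lemma tr_span a b X A :
  \tr ((a%:M + b *: X) * A) = a * \tr A + b * \tr (X * A).
Proof.
by rewrite mulrDl mxtraceD -scalerAl mxtraceZ [_%:M * A]mul_scalar_mx mxtraceZ.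
Qed.

(** A matrix conjugate to its opposite has trace zero, except in characteristic
    two, where opposites are equal. *)
Lemma commute_of_trace H X : \det H = 1 -> (\tr X != 0) || (2%:R == 0 :> F) ->
  H * X = X * H \/ H * X = - (X * H) -> H * X = X * H.
Proof.
move=> dH tX [//|e]; have uH := det1_unit dH.
suff c2 : 2%:R = 0 :> F by rewrite e -scaleN1r char2_eqN // scale1r.
case/orP: tX => [tX|/eqP //].
have tX2 : \tr X = - \tr X.
  by rewrite -{1}(tr_conj X dH) -mulrA -[X * H]opprK -e mulrN mulKr // raddfN.
by apply: (mulIf tX); rewrite mul0r mulr_natl mulr2n {1}tX2 addNr.
Qed.

Section Coset.
Variables (A X : 'M[F]_2) (t z : F).
Hypotheses (dA : \det A = 1) (dX : \det X = 1) (tA : \tr A = t) (tX : \tr X = t).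
Hypotheses (zE : \tr (X * A) = z) (nX : forall s, X != s%:M).
Local Notation C := (psl A ^: PSL 2 F)%g.

(** The centralizer of $x$ is the image of the conic of matrices $\alpha + \beta X$
    of determinant one. The elements of its coset through $a$ which are conjugate
    to $a$ come from the points of this conic on a line, given by the trace. *)
Lemma coset_class_span b : (t != 0) || (2%:R == 0 :> F) ->
    b \in C -> (psl X ^ b = psl X ^ psl A)%g ->
  exists al be, [/\ b = psl ((al%:M + be *: X) * A),
    al * t + be * z = t & al ^+ 2 + al * be * t + be ^+ 2 = 1].
Proof.
move=> t0 /(class_psl_lift dA)[B [dB tB ->]] /(conj_psl_eq dA dB dX) com.
have dH : \det (B * A^-1) = 1 by rewrite det_mulmx dB det1_inv ?mulr1.
have [|al [be e]] := commute_span (commute_of_trace dH _ com) nX.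
  by rewrite tX.
have BE : B = (al%:M + be *: X) * A by rewrite -e divrK // det1_unit.
exists al, be; split; first by rewrite -BE.
  by rewrite -zE -{1}tA -tr_span -BE tB tA.
by rewrite -{1}tX -det_span // -e.
Qed.

(** Eliminating $\alpha$ leaves a quadratic equation for $\beta$ without constant
    term: its root $0$ is $a$ itself. *)
Lemma line_conic al be : t != 0 ->
    al * t + be * z = t -> al ^+ 2 + al * be * t + be ^+ 2 = 1 ->
  be = 0 \/ t * (t ^+ 2 - 2%:R * z) + be * (z ^+ 2 - t ^+ 2 * z + t ^+ 2) = 0.
Proof.
move=> t0 e1 e2.
have alE : al = 1 - be * z / t.
  by apply: (mulIf t0); rewrite mulrBl mul1r divfK // -[X in X - _]e1 addrK.
have : be * (t * (t ^+ 2 - 2%:R * z) + be * (z ^+ 2 - t ^+ 2 * z + t ^+ 2)) = 0.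
  transitivity (t ^+ 2 * (al ^+ 2 + al * be * t + be ^+ 2 - 1)).
    by rewrite alE; field.
  by rewrite e2 subrr mulr0.
by move/eqP; rewrite mulf_eq0 => /orP[]/eqP; [left | right].
Qed.

Lemma line_conic0 al be : t != 0 -> al * t + be * z = t -> be = 0 -> al = 1.
Proof.
by move=> t0 e1 b0; apply: (mulIf t0); rewrite mul1r -[RHS]e1 b0 mul0r addr0.
Qed.

Variable v : coset_of 'Z(SL 2 F) -> L.
Hypotheses (balv : balanced C v) (Cx : psl X \in C).


Let nCG : {in C & PSL 2 F, forall x g, (x ^ g)%g \in C}.
Proof. by move=> _ g /imsetP[h Gh ->] Gg; rewrite -conjgM; apply/memJ_class/groupM. Qed.

(** The second point of intersection coincides with the first one when
    $t^2 = 2z$, and lies at infinity when $z^2 - t^2z + t^2 = 0$. *)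
Lemma balanced_tangent : t != 0 ->
    (t ^+ 2 - 2%:R * z == 0) (+) (z ^+ 2 - t ^+ 2 * z + t ^+ 2 == 0) ->
  v (psl A) = 0.
Proof.
move=> t0 tan; have t0' : (t != 0) || (2%:R == 0 :> F) by rewrite t0.
apply: (balanced_isolated balv Cx (class_refl _ _)).
move=> b Cb xb; have [al [be [-> e1 e2]]] := coset_class_span t0' Cb xb.
suff b0 : be = 0.
  by rewrite (line_conic0 t0 e1 b0) b0 scale0r addr0 mul1r.
have [//|/eqP] := line_conic t0 e1 e2; move: tan.
case: (eqVneq (t ^+ 2 - 2%:R * z) 0) => [->|n1] /=.
  by rewrite mulr0 add0r mulf_eq0 => /negPf->; rewrite orbF => /eqP.
case: (eqVneq (z ^+ 2 - t ^+ 2 * z + t ^+ 2) 0) => [->|//] _.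
by rewrite mulr0 addr0 mulf_eq0 (negPf t0) (negPf n1).
Qed.

(** When the second point of intersection is the conjugate of $a$ by an element
    of order three, the coset is an edge of a triangle. *)
Lemma balanced_secant R al be : t != 0 ->
    (t ^+ 2 - 2%:R * z != 0) || (z ^+ 2 - t ^+ 2 * z + t ^+ 2 != 0) ->
    \det R = 1 -> R ^+ 3 = 1 -> be != 0 ->
    R^-1 * A * R = (al%:M + be *: X) * A ->
  v (psl A) = 0.
Proof.
move=> t0 trans dR R3 be0 RE; have uA := det1_unit dA.
have t0' : (t != 0) || (2%:R == 0 :> F) by rewrite t0.
have dB : \det (R^-1 * A * R) = 1 by apply: det_conj.
have HE : R^-1 * A * R * A^-1 = al%:M + be *: X by rewrite RE mulrK.
have dH : \det (al%:M + be *: X) = 1 by rewrite -HE det_mulmx dB mul1r det1_inv.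
have e2 : al ^+ 2 + al * be * t + be ^+ 2 = 1 by rewrite -tX -det_span.
have e1 : al * t + be * z = t.
  by rewrite -zE -{1}tA -tr_span -RE tr_conj.
have xr : (psl X ^ (psl A ^ psl R) = psl X ^ psl A)%g.
  rewrite -pslJ //; apply/conj_psl_eq => //; left; rewrite HE.
  by rewrite mulrDl mulrDr -scalerAl -scalerAr; congr (_ + _); apply/esym/scalar_mxC.
have nscal s : al%:M + be *: X != s%:M.
  apply: contraNneq (nX ((s - al) / be)) => e.
  have -> : X = be^-1 *: (be *: X) by rewrite scalerA mulVf // scale1r.
  rewrite -[be *: X](addKr al%:M) e -raddfN -raddfD /= scale_scalar_mx.
  by rewrite mulrC addrC.
have Rr : (psl R ^+ 3 = 1)%g.
  rewrite -psl1 -R3 -[LHS]/(psl R * (psl R * psl R))%g -!pslM //.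
  by rewrite det_mulmx dR mulr1.
apply: (balanced_triangle nCG balv Cx (class_refl _ _) (psl_PSL dR) Rr _ xr).
  rewrite -pslJ //; apply/eqP => /psl_eqP[]// RA.
    by have := nscal 1; rewrite -HE RA divrr ?eqxx.
  by have := nscal (-1); rewrite -HE RA mulNr divrr // raddfN eqxx.
move=> b Cb xb; have [al' [be' [-> e1' e2']]] := coset_class_span t0' Cb xb.
have [b0|eb'] := line_conic t0 e1' e2'.
  by left; rewrite (line_conic0 t0 e1' b0) b0 scale0r addr0 mul1r.
have [b0|eb] := line_conic t0 e1 e2; first by rewrite b0 eqxx in be0.
have k0 : z ^+ 2 - t ^+ 2 * z + t ^+ 2 != 0.
  apply: contraTneq trans => k0; rewrite k0 eqxx orbF negbK.
  by move/eqP: eb; rewrite k0 mulr0 addr0 mulf_eq0 (negPf t0).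
have bb : be' = be.
  apply: (mulIf k0); apply: (addrI (t * (t ^+ 2 - 2%:R * z))).
  by rewrite eb eb'.
have aa : al' = al.
  by apply: (mulIf t0); apply: (addIr (be * z)); rewrite e1 -[RHS]e1' bb.
by right; rewrite aa bb -RE pslJ.
Qed.

End Coset.
End Criteria.

(** * Conjugacy classes of the projective special linear group *)

Section Classes.
Variables (F : finFieldType) (L : numClosedFieldType).
Local Open Scope ring_scope.
Implicit Types (A B M X H P R : 'M[F]_2) (t : F).

Definition separated A := \det A = 1 /\
  forall v : _ -> L, balanced (psl A ^: PSL 2 F)%g v -> v (psl A) = 0.

Lemma tr_nonscalar X : \det X = 1 -> \tr X ^+ 2 != 4%:R -> forall s, X != s%:M.
Proof.
move=> dX tX s; apply: contraNneq tX => Xs; move: dX.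
rewrite Xs mx2_scalar det_mx2 tr_mx2 mulr0 subr0 => s2.
by rewrite -mulr2n exprMn_n expr2 s2.
Qed.

Lemma conj_class A X : \det A = 1 -> \det X = 1 -> \tr X = \tr A ->
  \tr A ^+ 2 != 4%:R -> psl X \in (psl A ^: PSL 2 F)%g.
Proof.
move=> dA dX tXA tA; have [P dP PE] := conj_of_trace dA dX (esym tXA) tA.
exact: mem_class_psl dA dP PE.
Qed.

(** In the quadratic space of traceless matrices, $X - t/2$ is chosen orthogonal
    to $A - t/2$ and of the same norm: this gives $z = t^2/2$, a tangent line. *)
Lemma odd_semisimple_separated t :
  2%:R != 0 :> F -> t != 0 -> t ^+ 2 != 4%:R -> separated (mx2 0 (-1) 1 t).
Proof.
move=> c2 t0 t4; set A := mx2 _ _ _ _.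
have dA : \det A = 1 by rewrite det_mx2; ring.
have tA : \tr A = t by rewrite tr_mx2 add0r.
split=> // v balv.
have [|p' [s e]] := @binary_form_surj F 1 t 1 (t ^+ 2 / 4%:R - 1).
  by rewrite !mulr1 subr_eq0.
pose p := t / 2%:R + p'; pose z := t ^+ 2 / 2%:R.
have c4 : 4%:R != 0 :> F by rewrite (natrM _ 2 2) mulf_neq0.
pose X := mx2 p (z + s - t ^+ 2 + t * p) s (t - p).
have tX : \tr X = t by rewrite tr_mx2; ring.
have dX : \det X = 1.
  rewrite det_mx2; apply/subr0_eq.
  transitivity (t ^+ 2 / 4%:R - 1 - (1 * p' ^+ 2 + t * p' * s + 1 * s ^+ 2)).
    by rewrite /z /p; field; rewrite c4 c2.
  by rewrite e subrr.
have zE : \tr (X * A) = z by rewrite mx2M tr_mx2; ring.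
have nX := tr_nonscalar dX; rewrite tX in nX.
apply: (balanced_tangent dA dX tA tX zE (nX t4) balv _ t0).
  by apply: conj_class; rewrite ?tX ?tA.
rewrite (_ : t ^+ 2 - 2%:R * z = 0) ?eqxx; last by rewrite /z; field.
rewrite (_ : _ + t ^+ 2 = t ^+ 2 * (4%:R - t ^+ 2) / 4%:R); last first.
  by rewrite /z; field; rewrite c4 c2.
by rewrite 2!mulf_eq0 invr_eq0 expf_eq0 /= (negPf t0) (negPf c4) orbF subr_eq0 eq_sym.
Qed.

(** The eigenvectors of $X$ are the first basis vector and its image under $A$;
    the second point of the line on the conic is then at infinity. *)
Lemma char2_split_separated t l :
  2%:R = 0 :> F -> t != 0 -> l ^+ 2 + t * l + 1 = 0 -> separated (mx2 0 (-1) 1 t).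
Proof.
move=> c2 t0 tl; set A := mx2 _ _ _ _.
have dA : \det A = 1 by rewrite det_mx2; ring.
have tA : \tr A = t by rewrite tr_mx2 add0r.
have c4 : 4%:R = 0 :> F by rewrite (natrM _ 2 2) c2 mul0r.
have t4 : t ^+ 2 != 4%:R by rewrite c4 expf_neq0.
split=> // v balv; pose X := mx2 (t - l) 0 0 l.
have tX : \tr X = t by rewrite tr_mx2 subrK.
have dX : \det X = 1.
  rewrite det_mx2; apply: (@char2_eq _ c2 (t * l)).
  apply/subr0_eq; transitivity (- (l ^+ 2 + t * l + 1)); first by ring.
  by rewrite tl oppr0.
have zE : \tr (X * A) = t * l by rewrite mx2M tr_mx2; ring.
have nX := tr_nonscalar dX; rewrite tX in nX.
apply: (balanced_tangent dA dX tA tX zE (nX t4) balv _ t0).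
  by apply: conj_class; rewrite ?tX ?tA.
rewrite c2 mul0r subr0 expf_eq0 /= (negPf t0) /=; apply/eqP.
transitivity (t ^+ 2 * (l ^+ 2 + t * l + 1)); last by rewrite tl mulr0.
by apply: (@char2_eq _ c2 (- t ^+ 3 * l)); ring.
Qed.

(** Since traces vanish, the line of the coset is $\beta = 0$ as soon as
    $tr(XA) \ne 0$, and it is tangent to the conic at $a$. *)
Lemma char2_unipotent_separated :
  2%:R = 0 :> F -> separated (mx2 0 1 1 0).
Proof.
move=> c2; set A := mx2 _ _ _ _.
have c2' (x : F) : - x = x by apply: char2_eqN.
have dA : \det A = 1 by rewrite det_mx2 c2'; ring.
split=> // v balv; pose X : 'M[F]_2 := mx2 1 1 0 1.
have dX : \det X = 1 by rewrite det_mx2; ring.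
have nX s : X != s%:M.
  by apply/eqP; rewrite mx2_scalar => /mx2_inj[_ /eqP]; rewrite oner_eq0.
have tX : \tr X = 0 by rewrite tr_mx2 -c2; ring.
have tA : \tr A = 0 by rewrite tr_mx2 addr0.
have zE : \tr (X * A) = 1 by rewrite mx2M tr_mx2; ring.
have CX : psl X \in (psl A ^: PSL 2 F)%g.
  have [|||P dP PE] := conj_of_area dA dX (u := 1) (v := 0) (u' := 0) (v' := 1).
  - by rewrite tA tX.
  - by rewrite area_form_mx2 expr1n expr0n !mulr0 mulr1 addr0 subr0 oner_neq0.
  - by rewrite !area_form_mx2; apply: (@char2_eq _ c2 1); ring.
  exact: mem_class_psl dA dP PE.
apply: (balanced_isolated balv CX (class_refl _ _)) => b Cb xb.
have c2t : (0 != 0 :> F) || (2%:R == 0 :> F) by rewrite c2 !eqxx.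
have [al [be [-> ]]] := coset_class_span dA dX tA tX zE nX c2t Cb xb.
rewrite mulr0 add0r mulr1 => ->; rewrite mulr0 expr0n !addr0 => /eqP.
by rewrite sqrf_eq1 c2' orbb => /eqP ->; rewrite scale0r addr0 mul1r.
Qed.

(** An involution $b$ acts on traceless matrices as the half turn with axis $b$. *)
Lemma half_turn (a b c p r s : F) (B := mx2 a b c (- a)) (X := mx2 p r s (- p)) :
  \det B = 1 -> B^-1 * X * B = - (\tr (X * B) *: B + X).
Proof.
move=> dB; rewrite /B det1V // /X !mx2E; rewrite det_mx2 in dB.
have e y : y * (a * a + b * c + 1) = 0 by rewrite -dB; ring.
congr mx2; apply/subr0_eq;
  [rewrite -[RHS](e p) | rewrite -[RHS](e r) | rewrite -[RHS](e s) |
   rewrite -[RHS](e (- p))]; ring.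
Qed.

(** If the half turns with axes $a$ and $b$ agree on $x$ up to sign, then either
    $b = \pm a$, or $4 - z^2 = \det(zA + 2X)$ is a square, where $z = tr(XA)$. The
    element $x$ is chosen to exclude the latter. *)
Lemma involution_separated :
  2%:R != 0 :> F -> (4 <= #|F|)%N -> separated (mx2 0 (-1) 1 0).
Proof.
move=> c2 F4; set A := mx2 _ _ _ _.
have dA : \det A = 1 by rewrite det_mx2; ring.
have tA : \tr A = 0 by rewrite tr_mx2 addr0.
split=> // v balv.
have c4 : 4%:R != 0 :> F by rewrite (natrM _ 2 2) mulf_neq0.
have [t nsq] := exists_one_sub_sqr_nonsquare c2 F4.
have t0 : t != 0.
  by apply: contraNneq (nsq 1) => ->; rewrite expr0n subr0 expr1n.
have [x [p e]] := diagonal_form_surj (t ^+ 2 - 1) c2 (oner_neq0 F) (oner_neq0 F).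
pose s := x - t; pose z := 2%:R * t; pose r := z + s; pose X := mx2 p r s (- p).
have dX : \det X = 1.
  rewrite det_mx2; apply/subr0_eq.
  transitivity (t ^+ 2 - 1 - (1 * x ^+ 2 + 1 * p ^+ 2)).
    by rewrite /r /z /s; ring.
  by rewrite e subrr.
have tX : \tr X = 0 by rewrite tr_mx2 subrr.
have zE : \tr (X * A) = z by rewrite mx2M tr_mx2 /r; ring.
have z0 : z != 0 by rewrite mulf_neq0.
have CX : psl X \in (psl A ^: PSL 2 F)%g.
  by apply: conj_class; rewrite ?tX ?tA ?expr0n // eq_sym.
apply: (balanced_isolated balv CX (class_refl _ _)) => b Cb.
have [B [dB tB ->]] := class_psl_lift dA Cb.
rewrite -!pslJ // => /psl_eqP; rewrite !det_conj // => /(_ erefl erefl).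
have [b1 [b2 [b3 BE]]] : exists b1 b2 b3, B = mx2 b1 b2 b3 (- b1).
  exists (B 0 0), (B 0 1), (B 1 0); rewrite [LHS]mx2_eta; congr mx2.
  apply/eqP; rewrite eq_sym -subr_eq0 -opprD oppr_eq0; apply/eqP.
  by rewrite -(tr_mx2 _ (B 0 1) (B 1 0)) -mx2_eta tB tA.
have AE : A = mx2 0 (-1) 1 (- 0) by rewrite oppr0.
have -> : B^-1 * X * B = - (\tr (X * B) *: B + X) by rewrite BE half_turn // -BE.
have -> : A^-1 * X * A = - (z *: A + X) by rewrite -zE AE half_turn // -AE.
set w := \tr (X * B) => wB.
have : w *: B = z *: A \/ w *: B = - (z *: A + 2%:R *: X).
  case: wB => [/oppr_inj/addIr|]; first by left.
  rewrite opprK => wB; right; rewrite -[w *: B](addrK X) -[_ + X]opprK wB.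
  by rewrite scaler_nat mulr2n !opprD addrA.
case=> wE; have := congr1 determinant wE; rewrite !detZ dB mulr1.
  rewrite dA mulr1 => /eqP; rewrite eqf_sqr => /orP[]/eqP wz; apply/psl_eqP => //.
    by left; apply: (scalerI z0); rewrite -wE wz.
  by right; apply: (scalerI z0); rewrite scalerN -wE wz scaleNr opprK.
rewrite -[- _]scaleN1r detZ sqrrN expr1n mul1r !mx2E => w2.
case/eqP: (nsq (w / 2%:R)); rewrite exprMn w2.
apply: (mulfI c4); transitivity (4%:R * (\det X) - z ^+ 2).
  by rewrite dX /z; ring.
by rewrite det_mx2 /r /z; field.
Qed.


(** Every line is a secant here, and a triangle is needed. For the element $R$ of
    order three, $R^{-1}ARA^{-1}$ has trace $d = (s+t)^2$. If $1/d$ is not of the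
    form $y^2 + y$, this matrix generates a field isomorphic to the one generated
    by $A$, which therefore contains a conjugate $X$ of $A$. The entries $p$ and
    $s$ of $A$ are chosen so that this holds and $A$ has determinant one. *)
Lemma char2_nonsplit_separated t : 2%:R = 0 :> F -> (4 <= #|F|)%N -> t != 0 ->
    ~~ artin_schreier t^-1 ->
  exists2 A, separated A & \tr A = t.
Proof.
move=> c2 F4 t0 nt.
have c4 : 4%:R = 0 :> F by rewrite (natrM _ 2 2) c2 mul0r.
have t4 : t ^+ 2 != 4%:R by rewrite c4 expf_neq0.
have nt2 : ~~ artin_schreier (t^-1 ^+ 2) by rewrite artin_schreier_sqr.
have [e ne ne1] := exists_artin_schreier_pair c2 F4 nt.
have /artin_schreierP[y yE] := artin_schreierDN c2 nt2 ne.
pose p := t * y; pose s := t * e; pose A := mx2 p t s (p + t).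
have tA : \tr A = t by rewrite tr_mx2; apply: (@char2_eq _ c2 p); ring.
have dA : \det A = 1.
  rewrite det_mx2; apply: (@char2_eq _ c2 (- t ^+ 2 * e)).
  transitivity (t ^+ 2 * (y ^+ 2 + y - e)); first by rewrite /p /s; ring.
  apply/subr0_eq; transitivity (t ^+ 2 * (y ^+ 2 + y - (t^-1 ^+ 2 + e))).
    by apply: (@char2_eq _ c2 (t ^+ 2 * e)); field.
  by rewrite yE subrr mulr0.
exists A => //; split=> // v balv.
pose R : 'M[F]_2 := mx2 0 (-1) 1 (-1).
have dR : \det R = 1 by rewrite det_mx2; ring.
have R3 : R ^+ 3 = 1.
  by rewrite -[LHS]/(R * (R * R)) !mx2M mx2_1; congr mx2; ring.
pose B := R^-1 * A * R; pose H := B * A^-1; pose d := (s + t) ^+ 2.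
have dB : \det B = 1 by apply: det_conj.
have dH : \det H = 1 by rewrite det_mulmx dB mul1r det1_inv.
have tH : \tr H = d.
  rewrite /H /B /R /A !det1V // !mx2M tr_mx2.
  by apply: (@char2_eq _ c2 (p * (p + t) - s * t)); rewrite /d; ring.
have st : (s + t)^-1 = t^-1 / (e + 1).
  by rewrite (_ : s + t = t * (e + 1)) ?invfM // /s; ring.
have d0 : d != 0.
  rewrite expf_neq0 //; apply: contraNneq ne1 => st0.
  by rewrite -st st0 invr0 artin_schreier0.
have nd : ~~ artin_schreier (d^-1 ^+ 2).
  have -> : d^-1 = (s + t)^-1 ^+ 2 by rewrite /d exprVn.
  by rewrite !artin_schreier_sqr // st.
have /artin_schreierP[u uE] := artin_schreierDN c2 nt2 nd.
pose X := (t * u)%:M + (t / d) *: H.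
have dX : \det X = 1.
  rewrite det_span // tH; apply/subr0_eq.
  transitivity (t ^+ 2 * (u ^+ 2 + u - (t^-1 ^+ 2 + d^-1 ^+ 2))).
    by apply: (@char2_eq _ c2 (t ^+ 2 / d ^+ 2)); field; rewrite t0 d0.
  by rewrite uE subrr mulr0.
have tX : \tr X = t.
  rewrite mxtraceD mxtraceZ tH divfK // mxtrace_scalar.
  by apply: (@char2_eq _ c2 (t * u)); ring.
have nX := tr_nonscalar dX; rewrite tX in nX.
have CX : psl X \in (psl A ^: PSL 2 F)%g by apply: conj_class; rewrite ?tX ?tA.
have HE : H = (- (d * u))%:M + (d / t) *: X.
  rewrite scalerDr scale_scalar_mx scalerA addrA -raddfD /=.
  rewrite (_ : - (d * u) + _ = 0) ?raddf0 ?add0r; last by field.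
  by rewrite (_ : d / t * (t / d) = 1) ?scale1r //; field; rewrite t0 d0.
apply: (balanced_secant dA dX tA tX (erefl _) (nX t4) balv CX t0 _ dR R3
  (al := - (d * u)) (be := d / t)).
- by rewrite c2 mul0r subr0 expf_neq0.
- by rewrite mulf_neq0 ?invr_eq0.
by rewrite -HE divrK // det1_unit.
Qed.

(** The conjugates of $A$ are the transvections $u \mapsto u + m\omega(w, u)w$ with
    $w \ne 0$, where $\omega$ is the area and $w = e_1$ gives $A$. The matrix $R$
    permutes $e_1$, $ke_2$ and $-e_1 - ke_2$ cyclically, and $k$ is such that
    $R^{-1}ARA^{-1}$ has trace $-2$. The opposite $X$ of this matrix is then
    unipotent, and conjugate to $A$. *)
Lemma unipotent_separated (m i : F) :
  2%:R != 0 :> F -> m != 0 -> i ^+ 2 = -1 -> separated (mx2 1 m 0 1).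
Proof.
move=> c2 m0 i2; set A := mx2 _ _ _ _.
have dA : \det A = 1 by rewrite det_mx2; ring.
have tA : \tr A = 2%:R by rewrite tr_mx2.
have c4 : 4%:R != 0 :> F by rewrite (natrM _ 2 2) mulf_neq0.
have c8 : 8%:R != 0 :> F by rewrite (natrM _ 2 4) mulf_neq0.
have i0 : i != 0.
  by apply: contra_eq_neq i2 => ->; rewrite expr0n /= eq_sym oppr_eq0 oner_neq0.
split=> // v balv; pose k := 2%:R * i / m.
pose R : 'M[F]_2 := mx2 0 (- k^-1) k (-1).
have k0 : k != 0 by rewrite !mulf_neq0 ?invr_eq0.
have dR : \det R = 1 by rewrite det_mx2; field.
have R3 : R ^+ 3 = 1.
  by rewrite -[LHS]/(R * (R * R)) !mx2M mx2_1; congr mx2; field.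
pose X := mx2 (-1 + 2%:R * i) (- (2%:R * i * m)) (- (4%:R / m)) (3%:R - 2%:R * i).
have dX : \det X = 1.
  rewrite det_mx2; apply/subr0_eq; transitivity (- 4%:R * (i ^+ 2 + 1)).
    by field.
  by rewrite i2 addNr mulr0.
have tX : \tr X = 2%:R by rewrite tr_mx2; ring.
have nX s : X != s%:M.
  apply/eqP; rewrite mx2_scalar => /mx2_inj[_ _ /eqP].
  by rewrite oppr_eq0 mulf_eq0 invr_eq0 (negPf c4) (negPf m0).
have CX : psl X \in (psl A ^: PSL 2 F)%g.
  have [|||P dP PE] := conj_of_area dA dX (u := 0) (v := 1) (u' := m / 2%:R) (v' := 0).
  - by rewrite tA tX.
  - by rewrite area_form_mx2 (_ : _ - _ = - m) ?oppr_eq0 //; ring.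
  - by rewrite !area_form_mx2; field; rewrite m0 c2.
  exact: mem_class_psl dA dP PE.
have zE : \tr (X * A) = - 2%:R by rewrite mx2M tr_mx2; field.
apply: (balanced_secant dA dX tA tX zE nX balv CX c2 _ dR R3
  (al := 0) (be := -1)).
- by rewrite (_ : _ - _ = 8%:R) ?c8 //; ring.
- by rewrite oppr_eq0 oner_neq0.
rewrite raddf0 add0r scaleN1r det1V // /X mx2N !mx2M.
congr mx2; rewrite /k; try by (field; rewrite ?m0 ?i0 ?c2).
apply/subr0_eq; transitivity (- (4%:R / m) * (i ^+ 2 + 1)); last first.
  by rewrite i2 addNr mulr0.
by field; rewrite ?m0 ?i0 ?c2.
Qed.

End Classes.

Section Main.
Variables (F : finFieldType) (L : numClosedFieldType).
Local Open Scope ring_scope.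
Implicit Types (A B P : 'M[F]_2) (t : F).

Lemma area_form_nonscalar A : (forall s, A != s%:M) ->
  exists u v, area_form A u v != 0.
Proof.
rewrite [A]mx2_eta; move: (A 0 0) (A 0 1) (A 1 0) (A 1 1) => a b c d nA.
have [c0|c0] := eqVneq c 0; last first.
  by exists 1, 0; rewrite area_form_mx2 expr0n expr1n !mulr0 mulr1 addr0 subr0.
have [b0|b0] := eqVneq b 0; last first.
  by exists 0, 1; rewrite area_form_mx2 (_ : _ - _ = - b) ?oppr_eq0 //; ring.
exists 1, 1; rewrite area_form_mx2 b0 c0 (_ : _ - _ = d - a); last by ring.
by apply: contraNneq (nA a) => /subr0_eq ->; rewrite b0 c0 mx2_scalar.
Qed.

Lemma separated_nondegenerate A B P :
    \det A = 1 -> \det P = 1 -> P^-1 * A * P = B ->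
    real_set (psl A ^: PSL 2 F)%g -> separated L B ->
  killing_nondegenerate L (PSL 2 F) (psl A ^: PSL 2 F)%g.
Proof.
move=> dA dP PE realC [dB sepB].
have AB : (psl A ^: PSL 2 F = psl B ^: PSL 2 F)%g.
  exact/esym/class_eqP/(mem_class_psl dA dP PE).
rewrite AB in realC *.
exact: killing_nondegenerate_class (psl_PSL dB) realC sepB.
Qed.

(** Inversion changes the sign of the area form of a unipotent matrix, so that
    [-1] has to be a square. *)
Lemma real_unipotent (m : F) : 2%:R != 0 :> F -> m != 0 ->
    real_set (psl (mx2 1 m 0 1) ^: PSL 2 F)%g ->
  exists i : F, i ^+ 2 = -1.
Proof.
move=> c2 m0 realC; set A : 'M[F]_2 := mx2 _ _ _ _ in realC.
have dA : \det A = 1 by rewrite det_mx2; ring.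
have := realC _ (class_refl _ _); rewrite -pslV //.
case/imsetP => g /PSL_lift[P dP ->]; rewrite -pslJ // => /psl_eqP.
move=> /(_ (det1_inv dA) (det_conj dA dP)).
have AV : A^-1 = mx2 1 (- m) 0 1 by rewrite det1V // oppr0.
case=> AP; last first.
  have := congr1 mxtrace AP; rewrite raddfN /= tr_conj // AV !tr_mx2 => /eqP.
  by rewrite -subr_eq0 opprK -mulr2n -mulr_natl !mulf_eq0 (negPf c2).
have : P * A^-1 = A * P by rewrite AP !mulrA divrr ?det1_unit // mul1r.
move: dP; rewrite AV [P]mx2_eta.
move: (P 0 0) (P 0 1) (P 1 0) (P 1 1) => a b c d.
rewrite det_mx2 !mx2M => dP /mx2_inj[e1 e2 _ _].
have c0 : c = 0.
  apply: (mulfI m0); apply: (addrI a); transitivity (a * 1 + b * 0); last by ring.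
  by rewrite e1; ring.
have da : d = - a.
  apply: (mulfI m0); apply: (addrI b); transitivity (1 * b + m * d); first by ring.
  by rewrite -e2; ring.
by exists a; rewrite -dP c0 da; ring.
Qed.

Lemma killing_nondegenerate_PSL2 (C : {set coset_of 'Z(SL 2 F)}) :
    (4 <= #|F|)%N -> C \in classes (PSL 2 F) -> C <> [1]%g -> real_set C ->
  killing_nondegenerate L (PSL 2 F) C.
Proof.
move=> F4 /imsetP[x /PSL_lift[A dA ->] ->] C1 realC.
have nA s : A != s%:M.
  apply/eqP => As; apply: C1; move: (dA); rewrite As mx2_scalar det_mx2 mulr0 subr0.
  move/eqP; rewrite -expr2 sqrf_eq1 => /orP[]/eqP s1; rewrite -mx2_scalar s1.
    by rewrite psl1 class1G.
  have dN1 : \det ((-1)%:M : 'M[F]_2) = 1 by rewrite -s1 -As.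
  have -> : psl (-1)%:M = psl (1 : 'M[F]_2).
    by apply/(psl_eqP dN1 (det1 _ _)); right; rewrite raddfN.
  by rewrite psl1 class1G.
have dN t : \det (mx2 0 (-1) 1 t : 'M[F]_2) = 1 by rewrite det_mx2; ring.
have trN t : \tr (mx2 0 (-1) 1 t : 'M[F]_2) = t by rewrite tr_mx2 add0r.
have [u [v k0]] := area_form_nonscalar nA.
have [c2|c2] := eqVneq (2%:R : F) 0.
  have c4 : 4%:R = 0 :> F by rewrite (natrM _ 2 2) c2 mul0r.
  have [t0|t0] := eqVneq (\tr A) 0.
    have [h hk] := char2_sqrt (area_form A u v) c2.
    have dB : \det (mx2 0 1 1 0 : 'M[F]_2) = 1.
      by rewrite det_mx2; apply: (@char2_eq _ c2 (-1)); ring.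
    have [||P dP PE] := conj_of_area dA dB _ k0 (u' := h) (v' := 0).
    - by rewrite t0 tr_mx2 addr0.
    - by rewrite area_form_mx2 -hk; ring.
    exact: separated_nondegenerate dA dP PE realC (char2_unipotent_separated L c2).
  have t4 : \tr A ^+ 2 != 4%:R by rewrite c4 expf_neq0.
  have [/artin_schreierP[y yE]|nsplit] := boolP (artin_schreier (\tr A)^-1).
    have [P dP PE] := conj_of_trace dA (dN _) (esym (trN _)) t4.
    apply: separated_nondegenerate dA dP PE realC _.
    (* The square of the equation for y says that tr A * y ^+ 2 is an eigenvalue. *)
    apply: (@char2_split_separated _ _ _ (\tr A * y ^+ 2) c2 t0).
    apply/subr0_eq.
    transitivity (\tr A ^+ 2 * ((y ^+ 2 + y) ^+ 2 - (\tr A)^-1 ^+ 2)).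
      by apply: (@char2_eq _ c2 (1 - \tr A ^+ 2 * y ^+ 3)); field.
    by rewrite yE subrr mulr0.
  have [B sepB tB] := char2_nonsplit_separated L c2 F4 t0 nsplit.
  have [P dP PE] := conj_of_trace dA sepB.1 (esym tB) t4.
  exact: separated_nondegenerate dA dP PE realC sepB.
have [t4|t4] := eqVneq (\tr A ^+ 2) 4%:R; last first.
  have [P dP PE] := conj_of_trace dA (dN _) (esym (trN _)) t4.
  apply: separated_nondegenerate dA dP PE realC _.
  have [->|t0] := eqVneq (\tr A) 0; first exact: involution_separated.
  exact: odd_semisimple_separated.
wlog t2 : A dA nA k0 t4 realC {C1} / \tr A = 2%:R.
  move=> IH; move/eqP: (t4); rewrite (natrX _ 2 2) eqf_sqr => /orP[]/eqP tA.
    exact: IH.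
  have dNA : \det (- A) = 1 by rewrite -scaleN1r detZ sqrrN expr1n mul1r.
  have NA : psl (- A) = psl A by apply/psl_eqP => //; right.
  rewrite -NA; apply: IH; rewrite ?NA // ?raddfN ?sqrrN //=.
  - by move=> s; rewrite eqr_oppLR -raddfN; apply: nA.
  - apply: contraNneq k0; rewrite /area_form !mxE => e; apply/eqP.
    by rewrite -[RHS]oppr0 -e; ring.
  by rewrite tA opprK.
pose m := - area_form A u v; have m0 : m != 0 by rewrite oppr_eq0.
have dB : \det (mx2 1 m 0 1 : 'M[F]_2) = 1 by rewrite det_mx2; ring.
have [||P dP PE] := conj_of_area dA dB _ k0 (u' := 0) (v' := 1).
- by rewrite t2 tr_mx2.
- by rewrite area_form_mx2 /m; ring.
have AB : (psl A ^: PSL 2 F = psl (mx2 1 m 0 1) ^: PSL 2 F)%g.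
  exact/esym/class_eqP/(mem_class_psl dA dP PE).
have [i i2] : exists i : F, i ^+ 2 = -1 by apply: (real_unipotent c2 m0); rewrite -AB.
exact: separated_nondegenerate dA dP PE realC (unipotent_separated L c2 m0 i2).
Qed.

End Main.

Theorem theorem1p4 (R : realType) (q : nat) (F : finFieldType)
  (hF : #|F| = q) (hq : 4 <= q)
  (C : {set coset_of 'Z(SL 2 F)})
  (hC : C \in classes (PSL 2 F)) (hnontriv : C <> [1]%g) (hreal : real_set C) :
  killing_nondegenerate R[i] (PSL 2 F) C.
Proof. by apply: killing_nondegenerate_PSL2; rewrite ?hF. Qed.
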